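(* $\mathsf{DT}^2_{4,2}$ implies $\mathsf{ER}^2$.
   Context: Implications are in the sense of reverse mathematics over $\mathsf{RCA}_0$. $\mathsf{DT}^2_{4,2}$: for every $f:[\mathbb Q]^2\to4$ there is $S\subseteq\mathbb Q$ such that $(S,<)$ is a dense linear order without endpoints and $|f([S]^2)|\le2$. $\mathsf{ER}^2$ (Erdős–Rado theorem): for every $f:[\mathbb Q]^2\to2$ there exists $S\subseteq\mathbb Q$ such that either $S$ is infinite and $f$ is constantly $0$ on $[S]^2$, or $(S,<)$ has order type $\mathbb Q$ and $f$ is constantly $1$ on $[S]^2$. *)

(* Defs.v *)
(* Reverse mathematics over RCA_0, formalized semantically:
   "RCA_0 proves P -> Q" is rendered (via the completeness theorem for
   second-order arithmetic with Henkin semantics) as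
   "every L_2-structure satisfying the axioms of RCA_0 and P satisfies Q". *)
From Stdlib Require Import Arith.

Record L2 : Type := {
  num : Type;
  sset : Type;
  zro : num;
  one : num;
  add : num -> num -> num;
  mul : num -> num -> num;
  lt  : num -> num -> Prop;
  mem : num -> sset -> Prop
}.
Arguments zro {_}. Arguments one {_}. Arguments add {_} _ _.
Arguments mul {_} _ _. Arguments lt {_} _ _. Arguments mem {_} _ _.

Inductive term : Type :=
| TVar (i : nat) | TZero | TOne | TAdd (t u : term) | TMul (t u : term).

Inductive formula : Type :=
| FEq (t u : term) | FLt (t u : term) | FMem (t : term) (X : nat)
| FNot (A : formula) | FAnd (A B : formula) | FOr (A B : formula)
| FImp (A B : formula)
| FAllB (i : nat) (t : term) (A : formula)
| FExB (i : nat) (t : term) (A : formula)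
| FAll (i : nat) (A : formula) | FEx (i : nat) (A : formula)
| FAllS (X : nat) (A : formula) | FExS (X : nat) (A : formula).

Definition upd {A : Type} (e : nat -> A) (i : nat) (a : A) : nat -> A :=
  fun j => if Nat.eqb j i then a else e j.

Fixpoint eval (M : L2) (e : nat -> num M) (t : term) : num M :=
  match t with
  | TVar i => e i
  | TZero => zro
  | TOne => one
  | TAdd t u => add (eval M e t) (eval M e u)
  | TMul t u => mul (eval M e t) (eval M e u)
  end.

Fixpoint sat (M : L2) (e : nat -> num M) (E : nat -> sset M) (A : formula) : Prop :=
  match A with
  | FEq t u => eval M e t = eval M e u
  | FLt t u => lt (eval M e t) (eval M e u)
  | FMem t X => mem (eval M e t) (E X)
  | FNot A => ~ sat M e E A
  | FAnd A B => sat M e E A /\ sat M e E B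
  | FOr A B => sat M e E A \/ sat M e E B
  | FImp A B => sat M e E A -> sat M e E B
  | FAllB i t A => forall a, lt a (eval M e t) -> sat M (upd e i a) E A
  | FExB i t A => exists a, lt a (eval M e t) /\ sat M (upd e i a) E A
  | FAll i A => forall a, sat M (upd e i a) E A
  | FEx i A => exists a, sat M (upd e i a) E A
  | FAllS X A => forall S, sat M e (upd E X S) A
  | FExS X A => exists S, sat M e (upd E X S) A
  end.

Fixpoint bounded (A : formula) : bool :=
  match A with
  | FEq _ _ | FLt _ _ | FMem _ _ => true
  | FNot A => bounded A
  | FAnd A B | FOr A B | FImp A B => bounded A && bounded B
  | FAllB _ _ A | FExB _ _ A => bounded A
  | _ => false
  end.

Definition Sigma01 (A : formula) : Prop :=
  exists i B, A = FEx i B /\ bounded B = true.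
Definition Pi01 (A : formula) : Prop :=
  exists i B, A = FAll i B /\ bounded B = true.

Definition BasicAxioms (M : L2) : Prop :=
  (forall n : num M, add n one <> zro) /\
  (forall m n : num M, add m one = add n one -> m = n) /\
  (forall m : num M, add m zro = m) /\
  (forall m n : num M, add m (add n one) = add (add m n) one) /\
  (forall m : num M, mul m zro = zro) /\
  (forall m n : num M, mul m (add n one) = add (mul m n) m) /\
  (forall m : num M, ~ lt m zro) /\
  (forall m n : num M, lt m (add n one) <-> (lt m n \/ m = n)).

Definition Sigma01Induction (M : L2) : Prop :=
  forall (A : formula) (i : nat), Sigma01 A ->
  forall (e : nat -> num M) (E : nat -> sset M),
    sat M (upd e i zro) E A ->
    (forall a, sat M (upd e i a) E A -> sat M (upd e i (add a one)) E A) ->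
    forall a, sat M (upd e i a) E A.

Definition Delta01Comprehension (M : L2) : Prop :=
  forall (A B : formula) (i : nat), Sigma01 A -> Pi01 B ->
  forall (e : nat -> num M) (E : nat -> sset M),
    (forall a, sat M (upd e i a) E A <-> sat M (upd e i a) E B) ->
    exists X : sset M, forall a, mem a X <-> sat M (upd e i a) E A.

Definition RCA0 (M : L2) : Prop :=
  BasicAxioms M /\ Sigma01Induction M /\ Delta01Comprehension M.

Section Coding.
Variable M : L2.

Definition two : num M := add one one.
Definition four : num M := add two two.

(* Cantor pairing, as a relation: (m+n)(m+n+1) + 2m = 2k *)
Definition PairR (m n k : num M) : Prop :=
  add (mul (add m n) (add (add m n) one)) (add m m) = add k k.

Definition Code3 (p q i x : num M) : Prop :=
  exists u, PairR p q u /\ PairR u i x.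

(* A number k = <<a,c>,b> codes the rational (a - c)/(b + 1). *)
Definition qlt (k k' : num M) : Prop :=
  exists a c b a' c' b', Code3 a c b k /\ Code3 a' c' b' k' /\
    lt (add (mul a (add b' one)) (mul c' (add b one)))
       (add (mul a' (add b one)) (mul c (add b' one))).
Definition qeqv (k k' : num M) : Prop :=
  exists a c b a' c' b', Code3 a c b k /\ Code3 a' c' b' k' /\
    add (mul a (add b' one)) (mul c' (add b one)) =
    add (mul a' (add b one)) (mul c (add b' one)).

(* The rationals Q: the least code of each rational value; ordered by qlt. *)
Definition IsQ (k : num M) : Prop :=
  (exists a c b, Code3 a c b k) /\ (forall k', lt k' k -> ~ qeqv k' k).

(* f(p,q) = i, where the set F codes f : [Q]^2 -> k via triples <<p,q>,i>,
   a 2-element subset {p,q} being represented by p <_Q q. *)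
Definition Col (F : sset M) (p q i : num M) : Prop :=
  exists x, Code3 p q i x /\ mem x F.

Definition IsColoring (k : num M) (F : sset M) : Prop :=
  (forall x, mem x F -> exists p q i,
      Code3 p q i x /\ IsQ p /\ IsQ q /\ qlt p q /\ lt i k) /\
  (forall p q, IsQ p -> IsQ q -> qlt p q -> exists i, Col F p q i) /\
  (forall p q i j, Col F p q i -> Col F p q j -> i = j).

Definition SubQ (S : sset M) : Prop := forall x, mem x S -> IsQ x.

Definition DLOwoEnd (S : sset M) : Prop :=
  SubQ S /\ (exists x, mem x S) /\
  (forall p q, mem p S -> mem q S -> qlt p q ->
     exists r, mem r S /\ qlt p r /\ qlt r q) /\
  (forall p, mem p S -> exists q r, mem q S /\ mem r S /\ qlt q p /\ qlt p r).

(* S is finite iff it is bounded (Simpson); infinite = not finite *)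
Definition Infinite (S : sset M) : Prop :=
  ~ exists k, forall n, mem n S -> lt n k.

(* (S,<_Q) has order type Q: there is (a set coding) an order isomorphism
   h : Q -> S, coded by pairs <q, h(q)>. *)
Definition HRel (H : sset M) (q s : num M) : Prop :=
  exists x, PairR q s x /\ mem x H.

Definition OrderTypeQ (S : sset M) : Prop :=
  SubQ S /\ exists H : sset M,
    (forall x, mem x H -> exists q s, PairR q s x /\ IsQ q /\ mem s S) /\
    (forall q, IsQ q -> exists s, HRel H q s) /\
    (forall q s s', HRel H q s -> HRel H q s' -> s = s') /\
    (forall s, mem s S -> exists q, IsQ q /\ HRel H q s) /\
    (forall q q' s s', HRel H q s -> HRel H q' s' -> qlt q q' -> qlt s s').

Definition DT2_4_2 : Prop :=
  forall F : sset M, IsColoring four F ->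
  exists S : sset M, DLOwoEnd S /\
    exists c1 c2, forall p q i, mem p S -> mem q S -> qlt p q ->
      Col F p q i -> i = c1 \/ i = c2.

Definition ER2 : Prop :=
  forall F : sset M, IsColoring two F ->
  exists S : sset M, SubQ S /\
    ((Infinite S /\ forall p q i, mem p S -> mem q S -> qlt p q ->
        Col F p q i -> i = zro) \/
     (OrderTypeQ S /\ forall p q i, mem p S -> mem q S -> qlt p q ->
        Col F p q i -> i = one)).

End Coding.

(* Main.v *)
(* Multiply the given colouring of pairs of rationals by Sierpinski's colouring, which tells
   whether the rational order of a pair agrees with the order of its codes.  On a dense set [S]
   where the resulting 4-colouring takes two values, either all agreeing pairs have colour 0, or
   all disagreeing pairs do, or colour 0 is not taken at all.  In the first two cases the
   elements of [S] that are above (below) all elements of [S] with a smaller code form an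
   infinite set of colour 0.  In the third case [Q] is embedded into [S] by recursion on codes,
   each [q] going to the least code [t >= q] in [S] that is consistent with the earlier values;
   since the values dominate their arguments, the range is again a set.  Inside a model of RCA_0
   the recursion is carried out with finite sets coded by divisibility, as for Goedel's beta
   function. *)
From Stdlib Require Import Arith Classical Ring.
Require Import Defs.

Declare Scope num_scope.
Delimit Scope num_scope with num.
Notation "0" := zro : num_scope.
Notation "1" := one : num_scope.
Notation "x + y" := (add x y) : num_scope.
Notation "x * y" := (mul x y) : num_scope.
Notation "x < y" := (lt x y) : num_scope.
(* In this form a quantifier bounded by [<=] is an instance of [FExB] or [FAllB]. *)
Notation "x <= y" := (lt x (add y one)) : num_scope.
Local Open Scope num_scope.

(** * Bounded definability *)

Definition TDef (M : L2) (T : (nat -> num M) -> num M) : Prop :=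
  exists t, forall e, eval M e t = T e.

(** Predicates on assignments stand in for bounded formulas, so that no formula has to be written
    out. The set assignment is fixed because bounded formulas quantify over numbers only. *)
Definition Def0 (M : L2) (E : nat -> sset M) (P : (nat -> num M) -> Prop) : Prop :=
  exists A, bounded A = true /\ forall e, sat M e E A <-> P e.

Arguments TDef {M} T.
Arguments Def0 {M} E P.

Section Definability.
Variable M : L2.
Variable E : nat -> sset M.
Implicit Types T U : (nat -> num M) -> num M.
Implicit Types P Q : (nat -> num M) -> Prop.

Lemma tdef_var i : @TDef M (fun e => e i).
Proof. now exists (TVar i). Qed.

Lemma tdef_zero : @TDef M (fun _ => 0).
Proof. now exists TZero. Qed.

Lemma tdef_one : @TDef M (fun _ => 1).
Proof. now exists TOne. Qed.

Lemma tdef_add T U : TDef T -> TDef U -> TDef (fun e => T e + U e).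
Proof.
  intros [t Ht] [u Hu]. exists (TAdd t u). intros e; simpl. now rewrite Ht, Hu.
Qed.

Lemma tdef_mul T U : TDef T -> TDef U -> TDef (fun e => T e * U e).
Proof.
  intros [t Ht] [u Hu]. exists (TMul t u). intros e; simpl. now rewrite Ht, Hu.
Qed.

Lemma def0_ext P Q : (forall e, P e <-> Q e) -> Def0 E Q -> Def0 E P.
Proof.
  intros H [A [HA HQ]]. exists A. split; [exact HA|]. intros e. now rewrite HQ, H.
Qed.

Lemma def0_eq T U : TDef T -> TDef U -> Def0 E (fun e => T e = U e).
Proof.
  intros [t Ht] [u Hu]. exists (FEq t u). split; [reflexivity|].
  intros e; simpl. now rewrite Ht, Hu.
Qed.

Lemma def0_lt T U : TDef T -> TDef U -> Def0 E (fun e => T e < U e).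
Proof.
  intros [t Ht] [u Hu]. exists (FLt t u). split; [reflexivity|].
  intros e; simpl. now rewrite Ht, Hu.
Qed.

Lemma def0_mem i T : TDef T -> Def0 E (fun e => mem (T e) (E i)).
Proof.
  intros [t Ht]. exists (FMem t i). split; [reflexivity|].
  intros e; simpl. now rewrite Ht.
Qed.

Lemma def0_not P : Def0 E P -> Def0 E (fun e => ~ P e).
Proof.
  intros [A [HA HP]]. exists (FNot A). split; [exact HA|]. intros e; simpl. now rewrite HP.
Qed.

Lemma def0_and P Q : Def0 E P -> Def0 E Q -> Def0 E (fun e => P e /\ Q e).
Proof.
  intros [A [HA HP]] [B [HB HQ]]. exists (FAnd A B). split; [simpl; now rewrite HA, HB|].
  intros e; simpl. now rewrite HP, HQ.
Qed.

Lemma def0_or P Q : Def0 E P -> Def0 E Q -> Def0 E (fun e => P e \/ Q e).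
Proof.
  intros [A [HA HP]] [B [HB HQ]]. exists (FOr A B). split; [simpl; now rewrite HA, HB|].
  intros e; simpl. now rewrite HP, HQ.
Qed.

Lemma def0_imp P Q : Def0 E P -> Def0 E Q -> Def0 E (fun e => P e -> Q e).
Proof.
  intros [A [HA HP]] [B [HB HQ]]. exists (FImp A B). split; [simpl; now rewrite HA, HB|].
  intros e; simpl. now rewrite HP, HQ.
Qed.

Lemma def0_iff P Q : Def0 E P -> Def0 E Q -> Def0 E (fun e => P e <-> Q e).
Proof.
  intros HP HQ. apply (def0_and (fun e => P e -> Q e) (fun e => Q e -> P e));
    now apply def0_imp.
Qed.

(* The last hypothesis says that [i] is fresh for [Q]. *)
Lemma def0_exB i T (Q : (nat -> num M) -> num M -> Prop) :
  TDef T -> Def0 E (fun e => Q e (e i)) ->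
  (forall e a b, Q (upd e i a) b <-> Q e b) ->
  Def0 E (fun e => exists a, a < T e /\ Q e a).
Proof.
  intros [t Ht] [A [HA HQ]] Hf. exists (FExB i t A). split; [exact HA|].
  intros e; simpl. rewrite Ht. split; intros [a [Ha H]]; exists a; split; try exact Ha.
  - apply HQ in H. unfold upd at 2 in H. rewrite Nat.eqb_refl in H. now apply Hf in H.
  - apply HQ. unfold upd at 2. rewrite Nat.eqb_refl. now apply Hf.
Qed.

Lemma def0_allB i T (Q : (nat -> num M) -> num M -> Prop) :
  TDef T -> Def0 E (fun e => Q e (e i)) ->
  (forall e a b, Q (upd e i a) b <-> Q e b) ->
  Def0 E (fun e => forall a, a < T e -> Q e a).
Proof.
  intros [t Ht] [A [HA HQ]] Hf. exists (FAllB i t A). split; [exact HA|].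
  intros e; simpl. rewrite Ht. split; intros H a Ha; specialize (H a Ha).
  - apply HQ in H. unfold upd at 2 in H. rewrite Nat.eqb_refl in H. now apply Hf in H.
  - apply HQ. unfold upd at 2. rewrite Nat.eqb_refl. now apply Hf.
Qed.

End Definability.

Ltac tdef :=
  lazymatch goal with
  | |- TDef (fun e => e ?i) => exact (tdef_var _ i)
  | |- TDef (fun e => zro) => exact (tdef_zero _)
  | |- TDef (fun e => one) => exact (tdef_one _)
  | |- TDef (fun e => add (@?T e) (@?U e)) => apply (tdef_add _ T U); tdef
  | |- TDef (fun e => mul (@?T e) (@?U e)) => apply (tdef_mul _ T U); tdef
  end.

(* Extension point of [def0] for defined predicates. *)
Ltac def0_user n := fail.

(* Proves [Def0 E P]; the variables from [n] on are fresh for [P]. *)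
Ltac def0 n :=
  cbv beta;
  lazymatch goal with
  | |- Def0 ?E (fun e => exists a, lt a (@?T e) /\ @?Q e a) =>
      (* Keeping the index a literal lets [upd] compute at the other indices, so that freshness
         holds by conversion. *)
      let n' := eval cbv in (S n) in
      apply (def0_exB _ E n T Q); [tdef | def0 n' | intros; exact (iff_refl _)]
  | |- Def0 ?E (fun e => forall a, lt a (@?T e) -> @?Q e a) =>
      let n' := eval cbv in (S n) in
      apply (def0_allB _ E n T Q); [tdef | def0 n' | intros; exact (iff_refl _)]
  | |- Def0 ?E (fun e => @?P e /\ @?Q e) => apply (def0_and _ E P Q); def0 n
  | |- Def0 ?E (fun e => @?P e \/ @?Q e) => apply (def0_or _ E P Q); def0 n
  | |- Def0 ?E (fun e => @?P e <-> @?Q e) => apply (def0_iff _ E P Q); def0 n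
  | |- Def0 ?E (fun e => ~ @?P e) => apply (def0_not _ E P); def0 n
  | |- Def0 ?E (fun e => @?P e -> @?Q e) => apply (def0_imp _ E P Q); def0 n
  | |- Def0 ?E (fun e => @?T e = @?U e) => apply (def0_eq _ E T U); tdef
  | |- Def0 ?E (fun e => lt (@?T e) (@?U e)) => apply (def0_lt _ E T U); tdef
  | |- Def0 ?E (fun e => mem (@?T e) _) =>
      first [ apply (def0_mem _ E 0 T) | apply (def0_mem _ E 1 T)
            | apply (def0_mem _ E 2 T) | apply (def0_mem _ E 3 T) ]; tdef
  | |- _ => def0_user n
  end.

(** * Arithmetic in a model of RCA_0 *)

Section Model.
Variable M : L2.
Hypothesis HM : RCA0 M.

(** * Induction and comprehension for definable predicates *)

Definition env (x w a b c d f g : num M) : nat -> num M :=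
  fun i => match i with
           | 0%nat => x | 1%nat => w | 2%nat => a | 3%nat => b | 4%nat => c
           | 5%nat => d | 6%nat => f | _ => g
           end.

(* Variable 0 is the induction or comprehension variable, variable 1 the unbounded witness,
   and the variables 2 to 7 hold number constants. *)
Lemma sigma1_induction E
    (Q : num M -> num M -> num M -> num M -> num M -> num M -> num M -> num M -> Prop) :
  Def0 E (fun e => Q (e 0) (e 1) (e 2) (e 3) (e 4) (e 5) (e 6) (e 7))%nat ->
  forall a b c d f g,
  (exists w, Q 0 w a b c d f g) ->
  (forall x, (exists w, Q x w a b c d f g) -> exists w, Q (x + 1) w a b c d f g) ->
  forall x, exists w, Q x w a b c d f g.
Proof.
  intros [A [HA HQ]] a b c d f g H0 HS x.
  destruct HM as [_ [HI _]].
  assert (K : forall y, sat M (upd (env 0 0 a b c d f g) 0 y) E (FEx 1 A) <->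
                        exists w, Q y w a b c d f g).
  { intros y; simpl. split; intros [w Hw]; exists w; apply HQ in Hw || apply HQ; exact Hw. }
  apply K. apply HI.
  - exists 1%nat, A. auto.
  - now apply K.
  - intros y Hy. apply K, HS, K, Hy.
Qed.

Lemma delta0_induction E
    (P : num M -> num M -> num M -> num M -> num M -> num M -> num M -> Prop) :
  Def0 E (fun e => P (e 0) (e 2) (e 3) (e 4) (e 5) (e 6) (e 7))%nat ->
  forall a b c d f g,
  P 0 a b c d f g ->
  (forall x, P x a b c d f g -> P (x + 1) a b c d f g) ->
  forall x, P x a b c d f g.
Proof.
  intros HP a b c d f g H0 HS x.
  destruct (sigma1_induction E (fun x _ a b c d f g => P x a b c d f g) HP a b c d f g) with x
    as [_ H]; [| |exact H].
  - now exists 0.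
  - intros y [_ Hy]. exists 0. auto.
Qed.

Lemma delta1_comprehension E
    (P Q : num M -> num M -> num M -> num M -> num M -> num M -> num M -> num M -> Prop) :
  Def0 E (fun e => P (e 0) (e 1) (e 2) (e 3) (e 4) (e 5) (e 6) (e 7))%nat ->
  Def0 E (fun e => Q (e 0) (e 1) (e 2) (e 3) (e 4) (e 5) (e 6) (e 7))%nat ->
  forall a b c d f g,
  (forall x, (exists w, P x w a b c d f g) <-> (forall w, Q x w a b c d f g)) ->
  exists X, forall x, mem x X <-> exists w, P x w a b c d f g.
Proof.
  intros [A [HA HP]] [B [HB HQ]] a b c d f g HPQ.
  destruct HM as [_ [_ HC]].
  assert (KA : forall y, sat M (upd (env 0 0 a b c d f g) 0 y) E (FEx 1 A) <->
                        exists w, P y w a b c d f g).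
  { intros y; simpl. split; intros [w Hw]; exists w; apply HP in Hw || apply HP; exact Hw. }
  assert (KB : forall y, sat M (upd (env 0 0 a b c d f g) 0 y) E (FAll 1 B) <->
                        forall w, Q y w a b c d f g).
  { intros y; simpl. split; intros Hw w; specialize (Hw w); apply HQ in Hw || apply HQ; exact Hw. }
  destruct (HC (FEx 1 A) (FAll 1 B) 0%nat) with (e := env 0 0 a b c d f g) (E := E) as [X HX].
  - exists 1%nat, A. auto.
  - exists 1%nat, B. auto.
  - intros y. rewrite KA, KB. apply HPQ.
  - exists X. intros y. now rewrite HX, KA.
Qed.

Lemma delta0_comprehension E
    (P : num M -> num M -> num M -> num M -> num M -> num M -> num M -> Prop) :
  Def0 E (fun e => P (e 0) (e 2) (e 3) (e 4) (e 5) (e 6) (e 7))%nat ->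
  forall a b c d f g, exists X, forall x, mem x X <-> P x a b c d f g.
Proof.
  intros HP a b c d f g.
  destruct (delta1_comprehension E (fun x _ a b c d f g => P x a b c d f g)
              (fun x _ a b c d f g => P x a b c d f g) HP HP a b c d f g) as [X HX].
  - intros x. split; [intros [_ H] _; exact H|intros H; exists 0; exact (H 0)].
  - exists X. intros x. rewrite HX. split; [intros [_ H]; exact H|intros H; now exists 0].
Qed.

(* Induction and comprehension instances take an assignment of set variables, so they are
   vacuous in a structure without sets. *)
Variable Z : sset M.
Let EZ : nat -> sset M := fun _ => Z.

(** * The commutative semiring of numbers *)

Lemma succ_neq_zero (n : num M) : n + 1 <> 0.
Proof. apply HM. Qed.
Lemma succ_inj (m n : num M) : m + 1 = n + 1 -> m = n.
Proof. apply HM. Qed.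
Lemma add_0_r (m : num M) : m + 0 = m.
Proof. apply HM. Qed.
Lemma add_succ_r (m n : num M) : m + (n + 1) = (m + n) + 1.
Proof. apply HM. Qed.
Lemma mul_0_r (m : num M) : m * 0 = 0.
Proof. apply HM. Qed.
Lemma mul_succ_r (m n : num M) : m * (n + 1) = m * n + m.
Proof. apply HM. Qed.
Lemma lt_0_r (m : num M) : ~ m < 0.
Proof. apply HM. Qed.
Lemma lt_succ_r (m n : num M) : m <= n <-> m < n \/ m = n.
Proof. apply HM. Qed.

Lemma add_assoc (a b x : num M) : a + (b + x) = (a + b) + x.
Proof.
  revert x. refine (delta0_induction EZ (fun x a b _ _ _ _ => a + (b + x) = (a + b) + x)
    _ a b 0 0 0 0 _ _).
  - def0 8.
  - now rewrite !add_0_r.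
  - intros x IH. now rewrite !add_succ_r, IH.
Qed.

Lemma add_0_l (x : num M) : 0 + x = x.
Proof.
  revert x. refine (delta0_induction EZ (fun x _ _ _ _ _ _ => 0 + x = x)
    _ 0 0 0 0 0 0 _ _).
  - def0 8.
  - apply add_0_r.
  - intros x IH. now rewrite add_succ_r, IH.
Qed.

Lemma add_1_l (x : num M) : 1 + x = x + 1.
Proof.
  revert x. refine (delta0_induction EZ (fun x _ _ _ _ _ _ => 1 + x = x + 1)
    _ 0 0 0 0 0 0 _ _).
  - def0 8.
  - now rewrite add_0_r, add_0_l.
  - intros x IH. now rewrite add_succ_r, IH.
Qed.

Lemma add_comm (a x : num M) : a + x = x + a.
Proof.
  revert x. refine (delta0_induction EZ (fun x a _ _ _ _ _ => a + x = x + a)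
    _ a 0 0 0 0 0 _ _).
  - def0 8.
  - now rewrite add_0_r, add_0_l.
  - intros x IH. now rewrite add_succ_r, IH, <- add_assoc, <- add_1_l, add_assoc.
Qed.

Lemma mul_add_distr_l (a b x : num M) : a * (b + x) = a * b + a * x.
Proof.
  revert x. refine (delta0_induction EZ (fun x a b _ _ _ _ => a * (b + x) = a * b + a * x)
    _ a b 0 0 0 0 _ _).
  - def0 8.
  - now rewrite mul_0_r, !add_0_r.
  - intros x IH. now rewrite add_succ_r, !mul_succ_r, IH, add_assoc.
Qed.

Lemma mul_assoc (a b x : num M) : a * (b * x) = (a * b) * x.
Proof.
  revert x. refine (delta0_induction EZ (fun x a b _ _ _ _ => a * (b * x) = (a * b) * x)
    _ a b 0 0 0 0 _ _).
  - def0 8.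
  - now rewrite !mul_0_r.
  - intros x IH. now rewrite !mul_succ_r, mul_add_distr_l, IH.
Qed.

Lemma mul_add_distr_r (a b x : num M) : (a + b) * x = a * x + b * x.
Proof.
  revert x. refine (delta0_induction EZ (fun x a b _ _ _ _ => (a + b) * x = a * x + b * x)
    _ a b 0 0 0 0 _ _).
  - def0 8.
  - now rewrite !mul_0_r, add_0_r.
  - intros x IH. rewrite !mul_succ_r, IH.
    rewrite <- !add_assoc. f_equal. rewrite !add_assoc. f_equal. apply add_comm.
Qed.

Lemma mul_0_l (x : num M) : 0 * x = 0.
Proof.
  revert x. refine (delta0_induction EZ (fun x _ _ _ _ _ _ => 0 * x = 0)
    _ 0 0 0 0 0 0 _ _).
  - def0 8.
  - apply mul_0_r.
  - intros x IH. now rewrite mul_succ_r, IH, add_0_r.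
Qed.

Lemma mul_1_l (x : num M) : 1 * x = x.
Proof.
  revert x. refine (delta0_induction EZ (fun x _ _ _ _ _ _ => 1 * x = x)
    _ 0 0 0 0 0 0 _ _).
  - def0 8.
  - apply mul_0_r.
  - intros x IH. now rewrite mul_succ_r, IH.
Qed.

Lemma mul_comm (a x : num M) : a * x = x * a.
Proof.
  revert x. refine (delta0_induction EZ (fun x a _ _ _ _ _ => a * x = x * a)
    _ a 0 0 0 0 0 _ _).
  - def0 8.
  - now rewrite mul_0_r, mul_0_l.
  - intros x IH. now rewrite mul_succ_r, mul_add_distr_r, IH, mul_1_l.
Qed.

Lemma num_semi_ring : semi_ring_theory (0 : num M) 1 add mul eq.
Proof.
  constructor.
  - apply add_0_l.
  - apply add_comm.
  - apply add_assoc.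
  - apply mul_1_l.
  - apply mul_0_l.
  - apply mul_comm.
  - apply mul_assoc.
  - apply mul_add_distr_r.
Qed.

Add Ring num_ring : num_semi_ring.

(** * Order and cancellation *)

Lemma zero_or_succ (x : num M) : x = 0 \/ exists k, x = k + 1.
Proof.
  (* The quantifier is pulled in front of the disjunction to give the shape that [sigma1_induction]
     expects. *)
  assert (H : exists k, x = 0 \/ x = k + 1).
  { revert x. refine (sigma1_induction EZ (fun x k _ _ _ _ _ _ => x = 0 \/ x = k + 1)
      _ 0 0 0 0 0 0 _ _).
    - def0 8.
    - exists 0. now left.
    - intros x _. exists x. now right. }
  destruct H as [k [H|H]]; eauto.
Qed.

Lemma add_cancel_r (a b x : num M) : a + x = b + x -> a = b.
Proof.
  revert x. refine (delta0_induction EZ (fun x a b _ _ _ _ => a + x = b + x -> a = b)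
    _ a b 0 0 0 0 _ _).
  - def0 8.
  - now rewrite !add_0_r.
  - intros x IH H. rewrite !add_succ_r in H. apply IH, succ_inj, H.
Qed.

Lemma add_succ_neq (a k : num M) : a <> a + (k + 1).
Proof.
  intros H. apply (succ_neq_zero k), (add_cancel_r _ _ a). now rewrite add_0_l, add_comm.
Qed.

Lemma lt_add_succ (a x : num M) : a < a + (x + 1).
Proof.
  revert x. refine (delta0_induction EZ (fun x a _ _ _ _ _ => a < a + (x + 1))
    _ a 0 0 0 0 0 _ _).
  - def0 8.
  - rewrite add_succ_r, add_0_r. apply lt_succ_r. now right.
  - intros x IH. rewrite add_succ_r. apply lt_succ_r. now left.
Qed.

(** Trades the order for addition: inequalities are then proved by exhibiting a difference and
    calling [ring]. *)
Lemma lt_iff (m n : num M) : m < n <-> exists k, n = m + (k + 1).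
Proof.
  split; [|intros [k ->]; apply lt_add_succ].
  intros H. enough (K : exists k, m < n -> n = m + (k + 1)).
  { destruct K as [k Hk]. eauto. }
  clear H. revert n.
  refine (sigma1_induction EZ (fun x k m _ _ _ _ _ => m < x -> x = m + (k + 1))
    _ m 0 0 0 0 0 _ _).
  - def0 8.
  - exists 0. intros K. now apply lt_0_r in K.
  - intros x [k Hk]. destruct (classic (m < x)) as [K|K].
    + exists (k + 1). intros _. rewrite (Hk K) at 1. ring.
    + exists 0. intros K'. apply lt_succ_r in K' as [K'| ->]; [easy|ring].
Qed.

Lemma le_iff (m n : num M) : m <= n <-> exists k, n = m + k.
Proof.
  rewrite lt_iff. split; intros [k Hk]; exists k.
  - apply succ_inj. rewrite Hk. ring.
  - rewrite Hk. ring.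
Qed.

Lemma lt_irrefl (m : num M) : ~ m < m.
Proof. rewrite lt_iff. intros [k Hk]. exact (add_succ_neq _ _ Hk). Qed.

Lemma lt_trans (m n p : num M) : m < n -> n < p -> m < p.
Proof.
  rewrite !lt_iff. intros [k ->] [l ->]. exists (k + 1 + l). ring.
Qed.

Lemma lt_le_trans (m n p : num M) : m < n -> n <= p -> m < p.
Proof.
  rewrite le_iff, !lt_iff. intros [k ->] [l ->]. exists (k + l). ring.
Qed.

Lemma le_lt_trans (m n p : num M) : m <= n -> n < p -> m < p.
Proof.
  rewrite le_iff, !lt_iff. intros [k ->] [l ->]. exists (k + l). ring.
Qed.

Lemma le_trans (m n p : num M) : m <= n -> n <= p -> m <= p.
Proof.
  rewrite !le_iff. intros [k ->] [l ->]. exists (k + l). ring.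
Qed.

Lemma lt_le_incl (m n : num M) : m < n -> m <= n.
Proof. intros H. apply lt_succ_r. now left. Qed.

Lemma le_refl (m : num M) : m <= m.
Proof. apply lt_succ_r. now right. Qed.

Lemma le_add_r (m n : num M) : m <= m + n.
Proof. apply le_iff. now exists n. Qed.

Lemma le_add_l (m n : num M) : m <= n + m.
Proof. apply le_iff. exists n. ring. Qed.

Lemma lt_trichotomy (m n : num M) : m < n \/ m = n \/ n < m.
Proof.
  revert n. refine (delta0_induction EZ (fun n m _ _ _ _ _ => m < n \/ m = n \/ n < m)
    _ m 0 0 0 0 0 _ _).
  - def0 8.
  - right. destruct (zero_or_succ m) as [->|[k ->]]; [now left|right].
    rewrite <- (add_0_l (k + 1)). apply lt_add_succ.
  - intros n [H|[->|H]].
    + left. now apply lt_le_incl.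
    + left. apply le_refl.
    + right. apply lt_iff in H as [k ->].
      destruct (zero_or_succ k) as [->|[l ->]].
      * left. ring.
      * right. replace (n + (l + 1 + 1)) with ((n + 1) + (l + 1)) by ring. apply lt_add_succ.
Qed.

Lemma le_or_lt (m n : num M) : m <= n \/ n < m.
Proof.
  destruct (lt_trichotomy m n) as [H|[->|H]].
  - left. now apply lt_le_incl.
  - left. apply le_refl.
  - now right.
Qed.

Lemma lt_asym (m n : num M) : m < n -> ~ n < m.
Proof. intros H K. exact (lt_irrefl m (lt_trans _ _ _ H K)). Qed.

Lemma le_not_lt (m n : num M) : m <= n -> ~ n < m.
Proof. intros H K. exact (lt_irrefl m (le_lt_trans _ _ _ H K)). Qed.

Lemma add_lt_mono_r (p m n : num M) : m < n <-> m + p < n + p.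
Proof.
  rewrite !lt_iff. split; intros [k Hk]; exists k.
  - rewrite Hk. ring.
  - apply (add_cancel_r _ _ p). rewrite Hk. ring.
Qed.

Lemma mul_lt_mono (p m n : num M) : m < n -> m * (p + 1) < n * (p + 1).
Proof.
  rewrite !lt_iff. intros [k ->]. exists (k * p + k + p). ring.
Qed.

Lemma mul_lt_cancel (p m n : num M) : m * (p + 1) < n * (p + 1) -> m < n.
Proof.
  intros H. destruct (lt_trichotomy m n) as [K|[->|K]]; [exact K| |].
  - now apply lt_irrefl in H.
  - apply (mul_lt_mono p) in K. now apply lt_asym in H.
Qed.

Lemma mul_cancel (p m n : num M) : m * (p + 1) = n * (p + 1) -> m = n.
Proof.
  intros H. destruct (lt_trichotomy m n) as [K|[K|K]]; [|exact K|];
    apply (mul_lt_mono p) in K; rewrite H in K; now apply lt_irrefl in K.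
Qed.

(** If there were no least element, induction on [k] would show that [X] has no element below [k];
    this statement is bounded. *)
Lemma least_element (X : sset M) :
  (exists x, mem x X) -> exists x, mem x X /\ forall y, y < x -> ~ mem y X.
Proof.
  intros [x Hx]. apply NNPP. intros N.
  assert (K : forall k y, y < k -> ~ mem y X).
  {
    refine (delta0_induction (fun _ => X) (fun k _ _ _ _ _ _ => forall y, y < k -> ~ mem y X)
    _ 0 0 0 0 0 0 _ _).
    - def0 8.
    - intros y Hy. now apply lt_0_r in Hy.
    - intros z IH y Hy Hm. apply lt_succ_r in Hy as [Hy| ->].
      + exact (IH y Hy Hm).
      + apply N. now exists z. }
  exact (K (x + 1) x (le_refl x) Hx).
Qed.

(** * Pairs, rationals and colourings *)

(** Twice the Cantor code. Unlike the code itself it is a term, so it can bound quantifiers, and it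
    is already injective without halving. *)
Definition pair_index (m n : num M) : num M := (m + n) * (m + n + 1) + (m + m).

(** With [s = m + n], the index is at most [s * (s + 1) + 2 * s], which is below
    [(s + 1) * (s + 2)], where the next antidiagonal starts. *)
Lemma pair_index_lt (m n m' n' : num M) :
  m + n < m' + n' -> pair_index m n < pair_index m' n'.
Proof.
  rewrite !lt_iff. intros [k Hk]. unfold pair_index. rewrite Hk.
  exists ((m + n) * k + (m + n) * k + n + n + k * k + k + k + k + 1 + m' + m'). ring.
Qed.

Lemma double_inj (m n : num M) : m + m = n + n -> m = n.
Proof. intros H. apply (mul_cancel 1). transitivity (m + m); [ring|]. rewrite H. ring. Qed.

Lemma pair_index_inj (m n m' n' : num M) :
  pair_index m n = pair_index m' n' -> m = m' /\ n = n'.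
Proof.
  intros H. destruct (lt_trichotomy (m + n) (m' + n')) as [K|[K|K]].
  - apply pair_index_lt in K. rewrite H in K. now apply lt_irrefl in K.
  - unfold pair_index in H. rewrite K, (add_comm _ (m + m)), (add_comm _ (m' + m')) in H.
    apply add_cancel_r, double_inj in H. subst m'. split; [reflexivity|].
    rewrite !(add_comm m) in K. now apply add_cancel_r in K.
  - apply pair_index_lt in K. rewrite H in K. now apply lt_irrefl in K.
Qed.

Lemma PairR_ex (m n : num M) : exists k, PairR M m n k.
Proof.
  (* A product of two consecutive numbers is even; passing from [x] to [x + 1] raises its half by
     [x + 1]. *)
  assert (H : forall x : num M, exists w, x * (x + 1) = w + w).
  { refine (sigma1_induction EZ (fun x w _ _ _ _ _ _ => x * (x + 1) = w + w) _ 0 0 0 0 0 0 _ _).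
    - def0 8.
    - exists 0. ring.
    - intros x [w Hw]. exists (w + (x + 1)).
      transitivity (x * (x + 1) + (x + 1) + (x + 1)); [ring|]. rewrite Hw. ring. }
  destruct (H (m + n)) as [w Hw]. exists (w + m). unfold PairR. rewrite Hw. ring.
Qed.

Lemma PairR_inj (m n m' n' k : num M) : PairR M m n k -> PairR M m' n' k -> m = m' /\ n = n'.
Proof. intros H H'. apply pair_index_inj. unfold pair_index, PairR in *. congruence. Qed.

Lemma double_le (m n : num M) : m + m <= n + n -> m <= n.
Proof.
  intros H. destruct (le_or_lt m n) as [K|K]; [exact K|].
  apply le_not_lt in H. destruct H. apply lt_iff in K as [k ->].
  apply lt_iff. exists (k + k + 1). ring.
Qed.

Lemma PairR_le_l (m n k : num M) : PairR M m n k -> m <= k.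
Proof. intros H. apply double_le. rewrite <- H. apply le_add_l. Qed.

Lemma PairR_le_r (m n k : num M) : PairR M m n k -> n <= k.
Proof.
  intros H. apply double_le. rewrite <- H. apply le_iff.
  destruct (zero_or_succ n) as [->|[n' ->]].
  - exists (m * m + m + m + m). ring.
  - exists (m * m + m * n' + m * n' + n' * n' + n' + m * (1 + 1 + 1 + 1 + 1)). ring.
Qed.

Lemma PairR_le_index (m n k : num M) : PairR M m n k -> k <= pair_index m n.
Proof. intros H. unfold pair_index. rewrite H. apply le_add_r. Qed.

(** The suffix [_bd] marks an equivalent form with bounded quantifiers only, as [def0] requires. The
    bounds come from the fact that a code dominates its components. *)
Definition Code3_bd (p q i x : num M) : Prop :=
  exists u, u <= x /\ (PairR M p q u /\ PairR M u i x).

Lemma Code3_iff (p q i x : num M) : Code3 M p q i x <-> Code3_bd p q i x.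
Proof.
  split; intros [u H].
  - exists u. split; [eapply PairR_le_l; apply H|exact H].
  - exists u. apply H.
Qed.

Lemma Code3_ex (p q i : num M) : exists x, Code3 M p q i x.
Proof. destruct (PairR_ex p q) as [u Hu], (PairR_ex u i) as [x Hx]. now exists x, u. Qed.

Lemma Code3_inj (p q i p' q' i' x : num M) :
  Code3 M p q i x -> Code3 M p' q' i' x -> p = p' /\ q = q' /\ i = i'.
Proof.
  intros [u [Hu Hx]] [u' [Hu' Hx']]. destruct (PairR_inj _ _ _ _ _ Hx Hx') as [-> ->].
  destruct (PairR_inj _ _ _ _ _ Hu Hu') as [-> ->]. auto.
Qed.

Lemma Code3_le (p q i x : num M) : Code3 M p q i x -> p <= x /\ q <= x /\ i <= x.
Proof.
  intros [u [Hu Hx]].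
  pose proof (PairR_le_l _ _ _ Hu). pose proof (PairR_le_r _ _ _ Hu).
  pose proof (PairR_le_l _ _ _ Hx). pose proof (PairR_le_r _ _ _ Hx).
  eauto using le_trans.
Qed.

Definition qlt_bd (k k' : num M) : Prop :=
  exists a, a <= k /\ exists c, c <= k /\ exists b, b <= k /\
  exists a', a' <= k' /\ exists c', c' <= k' /\ exists b', b' <= k' /\
    (Code3_bd a c b k /\ Code3_bd a' c' b' k' /\
     a * (b' + 1) + c' * (b + 1) < a' * (b + 1) + c * (b' + 1)).

Lemma qlt_iff (k k' : num M) : qlt M k k' <-> qlt_bd k k'.
Proof.
  split.
  - intros (a & c & b & a' & c' & b' & H & H' & L).
    destruct (Code3_le _ _ _ _ H) as (? & ? & ?), (Code3_le _ _ _ _ H') as (? & ? & ?).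
    apply Code3_iff in H, H'. unfold qlt_bd. eauto 20.
  - intros (a & _ & c & _ & b & _ & a' & _ & c' & _ & b' & _ & H & H' & L).
    apply Code3_iff in H, H'. now exists a, c, b, a', c', b'.
Qed.

Definition qeqv_bd (k k' : num M) : Prop :=
  exists a, a <= k /\ exists c, c <= k /\ exists b, b <= k /\
  exists a', a' <= k' /\ exists c', c' <= k' /\ exists b', b' <= k' /\
    (Code3_bd a c b k /\ Code3_bd a' c' b' k' /\
     a * (b' + 1) + c' * (b + 1) = a' * (b + 1) + c * (b' + 1)).

Lemma qeqv_iff (k k' : num M) : qeqv M k k' <-> qeqv_bd k k'.
Proof.
  split.
  - intros (a & c & b & a' & c' & b' & H & H' & L).
    destruct (Code3_le _ _ _ _ H) as (? & ? & ?), (Code3_le _ _ _ _ H') as (? & ? & ?).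
    apply Code3_iff in H, H'. unfold qeqv_bd. eauto 20.
  - intros (a & _ & c & _ & b & _ & a' & _ & c' & _ & b' & _ & H & H' & L).
    apply Code3_iff in H, H'. now exists a, c, b, a', c', b'.
Qed.

Definition IsQ_bd (k : num M) : Prop :=
  (exists a, a <= k /\ exists c, c <= k /\ exists b, b <= k /\ Code3_bd a c b k) /\
  (forall k', k' < k -> ~ qeqv_bd k' k).

Lemma IsQ_iff (k : num M) : IsQ M k <-> IsQ_bd k.
Proof.
  split; intros [H K]; split.
  - destruct H as (a & c & b & H). destruct (Code3_le _ _ _ _ H) as (? & ? & ?).
    apply Code3_iff in H. eauto 10.
  - intros k' L. rewrite <- qeqv_iff. auto.
  - destruct H as (a & _ & c & _ & b & _ & H). apply Code3_iff in H. eauto.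
  - intros k' L. rewrite qeqv_iff. auto.
Qed.

(** Here the components are given and the code is sought, so the term [pair_index] supplies the
    bounds. *)
Definition Col_bd (F : sset M) (p q i : num M) : Prop :=
  exists u, u <= pair_index p q /\ exists x, x <= pair_index u i /\
    (PairR M p q u /\ PairR M u i x /\ mem x F).

Lemma Col_iff (F : sset M) (p q i : num M) : Col M F p q i <-> Col_bd F p q i.
Proof.
  split.
  - intros (x & (u & Hu & Hx) & H). exists u. split; [now apply PairR_le_index|].
    exists x. split; [now apply PairR_le_index|]. auto.
  - intros (u & _ & x & _ & Hu & Hx & H). exists x. split; [now exists u|exact H].
Qed.

Definition HRel_bd (H : sset M) (q s : num M) : Prop :=
  exists x, x <= pair_index q s /\ (PairR M q s x /\ mem x H).

Lemma HRel_iff (H : sset M) (q s : num M) : HRel M H q s <-> HRel_bd H q s.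
Proof.
  split.
  - intros (x & Hx & K). exists x. split; [now apply PairR_le_index|]. auto.
  - intros (x & _ & Hx & K). now exists x.
Qed.

Ltac def0_user n ::=
  lazymatch goal with
  | |- Def0 ?E (fun e => PairR M (@?T e) (@?U e) (@?V e)) =>
      unfold PairR; def0 n
  | |- Def0 ?E (fun e => Code3 M (@?T e) (@?U e) (@?V e) (@?W e)) =>
      apply (def0_ext _ E _ (fun e => Code3_bd (T e) (U e) (V e) (W e)));
      [intro; apply Code3_iff | unfold Code3_bd; def0 n]
  | |- Def0 ?E (fun e => qlt M (@?T e) (@?U e)) =>
      apply (def0_ext _ E _ (fun e => qlt_bd (T e) (U e)));
      [intro; apply qlt_iff | unfold qlt_bd, Code3_bd; def0 n]
  | |- Def0 ?E (fun e => IsQ M (@?T e)) =>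
      apply (def0_ext _ E _ (fun e => IsQ_bd (T e)));
      [intro; apply IsQ_iff | unfold IsQ_bd, qeqv_bd, Code3_bd; def0 n]
  | |- Def0 ?E (fun e => Col M ?F (@?T e) (@?U e) (@?V e)) =>
      apply (def0_ext _ E _ (fun e => Col_bd F (T e) (U e) (V e)));
      [intro; apply Col_iff | unfold Col_bd, pair_index; def0 n]
  | |- Def0 ?E (fun e => HRel M ?H (@?T e) (@?U e)) =>
      apply (def0_ext _ E _ (fun e => HRel_bd H (T e) (U e)));
      [intro; apply HRel_iff | unfold HRel_bd, pair_index; def0 n]
  end.

(** * The order of the rationals *)

Lemma qlt_irrefl (p : num M) : ~ qlt M p p.
Proof.
  intros (a & c & b & a' & c' & b' & H & H' & L).
  destruct (Code3_inj _ _ _ _ _ _ _ H H') as (<- & <- & <-). now apply lt_irrefl in L.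
Qed.

Lemma add_lt_mono (m n p q : num M) : m < n -> p < q -> m + p < n + q.
Proof.
  rewrite !lt_iff. intros [k ->] [l ->]. exists (k + l + 1). ring.
Qed.

Lemma qlt_trans (p q r : num M) : qlt M p q -> qlt M q r -> qlt M p r.
Proof.
  intros (a & c & b & a' & c' & b' & Hp & Hq & L)
         (a1 & c1 & b1 & a'' & c'' & b'' & Hq1 & Hr & L').
  destruct (Code3_inj _ _ _ _ _ _ _ Hq Hq1) as (<- & <- & <-).
  exists a, c, b, a'', c'', b''. split; [exact Hp|split; [exact Hr|]].
  (* After multiplying by the middle denominator and adding the terms of the middle fraction to both
     sides, the goal is the sum of the two hypotheses multiplied by [b'' + 1] and [b + 1]. *)
  apply (mul_lt_cancel b').
  apply (add_lt_mono_r (a' * (b + 1) * (b'' + 1) + c' * (b + 1) * (b'' + 1))).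
  apply (mul_lt_mono b'') in L. apply (mul_lt_mono b) in L'.
  pose proof (add_lt_mono _ _ _ _ L L') as K.
  match goal with |- ?x < ?y => match type of K with ?x' < ?y' =>
    replace x with x' by ring; replace y with y' by ring end end. exact K.
Qed.

Lemma qlt_asym (p q : num M) : qlt M p q -> ~ qlt M q p.
Proof. intros H K. exact (qlt_irrefl p (qlt_trans _ _ _ H K)). Qed.

Lemma qlt_total (p q : num M) : IsQ M p -> IsQ M q -> qlt M p q \/ p = q \/ qlt M q p.
Proof.
  intros [(a & c & b & Hp) Mp] [(a' & c' & b' & Hq) Mq].
  destruct (lt_trichotomy (a * (b' + 1) + c' * (b + 1)) (a' * (b + 1) + c * (b' + 1)))
    as [L|[L|L]].
  - left. now exists a, c, b, a', c', b'.
  (* Equal values: neither code can be smaller, since each is the least code of its value. *)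
  - right; left. destruct (lt_trichotomy p q) as [K|[K|K]]; [|exact K|].
    + destruct (Mq p K). now exists a, c, b, a', c', b'.
    + destruct (Mp q K). now exists a', c', b', a, c, b.
  - right; right. now exists a', c', b', a, c, b.
Qed.

(** * Codes for finite sets *)

(* [b] divisible by [1, ..., k] makes the moduli [1 + (i + 1) * b] with [i < k] pairwise
   coprime; the number [a] then codes the set of those [i] whose modulus divides [a]. *)
Definition coded (a b i : num M) : Prop := exists y, y <= a /\ a = y * (1 + (i + 1) * b).

Lemma coded_iff (a b i : num M) : coded a b i <-> exists y, a = y * (1 + (i + 1) * b).
Proof.
  split; intros [y H]; exists y; [apply H|]. split; [|exact H].
  rewrite H. apply le_iff. exists (y * ((i + 1) * b)). ring.
Qed.

(** Stands in for subtracting two multiples of [1 + d]. The case [q < p] is impossible, as the left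
    side would exceed the right one. *)
Lemma divisible_sub (a p q d : num M) : a + p * (1 + d) = q * (1 + d) -> exists y, a = y * (1 + d).
Proof.
  intros H. destruct (le_or_lt p q) as [K|K].
  - apply le_iff in K as [r ->]. exists r. apply (add_cancel_r _ _ (p * (1 + d))).
    rewrite H. ring.
  - apply lt_iff in K as [r ->].
    destruct (add_succ_neq (q * (1 + d)) (a + r + r * d + d)). rewrite <- H at 1. ring.
Qed.

(** Modulo [1 + (i + 1) * b], the number [(i + 1) * (1 + (n + 1) * b)] is congruent to [i - n] and
    [(i + 1) * b] to -1. If [b = |i - n| * y], then [(i + 1) * (i + 1) * y] is therefore, up to
    sign, an inverse of [1 + (n + 1) * b], and this factor can be cancelled. The two cases differ in
    the sign, which is avoided by moving terms across the equation. *)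
Lemma coded_mul (k b : num M) :
  (forall i, i < k -> exists y, b = (i + 1) * y) ->
  forall a i n, i < k -> n < k -> i <> n -> coded (a * (1 + (n + 1) * b)) b i -> coded a b i.
Proof.
  intros Hb a i n Hi Hn D C. apply coded_iff in C as [z Hz]. apply coded_iff.
  destruct (lt_trichotomy i n) as [K|[K|K]]; [|easy|]; apply lt_iff in K as [m K].
  - destruct (Hb m) as [y Hy].
    { eapply le_lt_trans; [|exact Hn]. rewrite K. apply le_iff. exists (i + 1). ring. }
    apply (divisible_sub _ ((n + 1) * a * y * (i + 1)) ((i + 1) * (i + 1) * z * y + a)).
    transitivity ((i + 1) * (i + 1) * y * (a * (1 + (n + 1) * b)) + a * (1 + (i + 1) * b));
      [|rewrite Hz; ring].
    rewrite K, Hy. ring.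
  - destruct (Hb m) as [y Hy].
    { eapply le_lt_trans; [|exact Hi]. rewrite K. apply le_iff. exists (n + 1). ring. }
    apply (divisible_sub _ ((i + 1) * (i + 1) * z * y) ((n + 1) * a * y * (i + 1) + a)).
    transitivity (a + (i + 1) * (i + 1) * y * (a * (1 + (n + 1) * b))); [rewrite Hz; ring|].
    rewrite K, Hy. ring.
Qed.

(** The construction is that of the factorial: start from 1 and multiply by [k + 1] at each step. *)
Lemma common_multiple (k : num M) :
  exists b, 0 < b /\ forall i, i < k -> exists y, b = (i + 1) * y.
Proof.
  assert (H : exists b, 0 < b /\ forall i, i < k -> exists y, y <= b /\ b = (i + 1) * y).
  { revert k. refine (sigma1_induction EZ (fun k b _ _ _ _ _ _ =>
      0 < b /\ forall i, i < k -> exists y, y <= b /\ b = (i + 1) * y) _ 0 0 0 0 0 0 _ _).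
    - def0 8.
    - exists 1. split.
      + apply lt_iff. exists 0. ring.
      + intros i Hi. now apply lt_0_r in Hi.
    - intros k [b [Hb IH]]. exists ((k + 1) * b). split.
      + apply lt_iff in Hb as [c ->]. apply lt_iff. exists (k * c + k + c). ring.
      + intros i Hi. apply lt_succ_r in Hi as [Hi| ->].
        * destruct (IH i Hi) as [y [_ Hy]]. exists ((k + 1) * y). split; [|rewrite Hy; ring].
          apply le_iff. exists (i * (k + 1) * y). rewrite Hy. ring.
        * exists b. split; [|ring]. apply le_iff. exists (k * b). ring. }
  destruct H as [b [Hb H]]. exists b. split; [exact Hb|].
  intros i Hi. destruct (H i Hi) as [y [_ Hy]]. now exists y.
Qed.

Lemma finite_set_code (X : sset M) (k : num M) :
  exists a b, forall i, i < k -> (coded a b i <-> mem i X).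
Proof.
  destruct (common_multiple k) as [b [Hb D]].
  (* With [b] fixed for the whole range below [k], the code [a] is built by induction on [n],
     acquiring the modulus of [n] as a factor when [n] belongs to [X]. *)
  enough (H : forall n, exists a, forall i, i < k -> (coded a b i <-> i < n /\ mem i X)).
  { destruct (H k) as [a Ha]. exists a, b. intros i Hi. rewrite Ha; tauto. }
  refine (sigma1_induction (fun _ => X) (fun n a k b _ _ _ _ =>
    forall i, i < k -> (coded a b i <-> i < n /\ mem i X)) _ k b 0 0 0 0 _ _).
  - unfold coded. def0 8.
  (* As [0 < b], every modulus exceeds 1, so 1 codes the empty set. *)
  - exists 1. intros i _. split.
    + intros C. exfalso. apply coded_iff in C as [y Hy].
      apply lt_iff in Hb as [c ->]. destruct (zero_or_succ y) as [->|[z ->]].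
      * rewrite mul_0_l in Hy. apply (succ_neq_zero 0). rewrite Hy at 1. ring.
      * apply (add_succ_neq 1 (z + i + i * c + c + z * i + z * i * c + z * c + z)).
        rewrite Hy at 1. ring.
    + intros [L _]. now apply lt_0_r in L.
  - intros n [a Ha]. destruct (classic (n < k /\ mem n X)) as [[Hn Nn]|N].
    + exists (a * (1 + (n + 1) * b)). intros i Hi. split.
      * intros C. destruct (classic (i = n)) as [->|K]; [split; [apply le_refl|exact Nn]|].
        apply (coded_mul k b D a i n Hi Hn K) in C. apply Ha in C as [L Mi]; [|exact Hi].
        split; [now apply lt_le_incl|exact Mi].
      * intros [L Mi]. apply coded_iff. apply lt_succ_r in L as [L| ->]; [|now exists a].
        destruct (proj2 (Ha i Hi) (conj L Mi)) as [y [_ Hy]].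
        exists (y * (1 + (n + 1) * b)). rewrite Hy at 1. ring.
    + exists a. intros i Hi. rewrite (Ha i Hi), lt_succ_r.
      split; [tauto|intros [[L| ->] Mi]; tauto].
Qed.

(** * Dense suborders of the rationals *)

Definition qdir (d : bool) (p q : num M) : Prop := if d then qlt M p q else qlt M q p.

Definition sets (X Y W : sset M) : nat -> sset M :=
  fun i => match i with 0%nat => X | 1%nat => Y | _ => W end.

(** The maximum for [d = true], the minimum for [d = false]. By induction on [n], the extremum of
    the elements below [n] is compared with [n]. *)
Lemma bounded_extremum (d : bool) (X : sset M) (k : num M) :
  (forall x, mem x X -> IsQ M x /\ x < k) -> (exists x, mem x X) ->
  exists m, mem m X /\ forall x, mem x X -> x = m \/ qdir d x m.
Proof.
  intros HX [x0 Hx0].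
  assert (H : forall n, (exists x, x < n /\ mem x X) ->
    exists m, m < n /\ (mem m X /\ forall x, x < n -> mem x X -> x = m \/ qdir d x m)).
  { refine (delta0_induction (fun _ => X) (fun n _ _ _ _ _ _ => (exists x, x < n /\ mem x X) ->
      exists m, m < n /\ (mem m X /\ forall x, x < n -> mem x X -> x = m \/ qdir d x m))
      _ 0 0 0 0 0 0 _ _).
    - destruct d; unfold qdir; def0 8.
    - intros [x [L _]]. now apply lt_0_r in L.
    - intros n IH Ex. destruct (classic (exists x, x < n /\ mem x X)) as [K|K].
      + destruct (IH K) as [m [Lm [Hm Mm]]]. destruct (classic (mem n X)) as [N|N].
        * assert (T : m = n \/ qdir d m n \/ qdir d n m).
          { destruct (HX m Hm) as [Qm _], (HX n N) as [Qn _].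
            destruct d; simpl; destruct (qlt_total m n Qm Qn) as [?|[?|?]]; auto. }
          destruct T as [T|[T|T]].
          -- subst m. now apply lt_irrefl in Lm.
          -- exists n. split; [apply le_refl|split; [exact N|]].
             intros x Lx Mx. apply lt_succ_r in Lx as [Lx| ->]; [|now left]. right.
             destruct (Mm x Lx Mx) as [->|Q]; [exact T|].
             destruct d; simpl in *; eauto using qlt_trans.
          -- exists m. split; [now apply lt_le_incl|split; [exact Hm|]].
             intros x Lx Mx. apply lt_succ_r in Lx as [Lx| ->]; auto.
        * exists m. split; [now apply lt_le_incl|split; [exact Hm|]].
          intros x Lx Mx. apply lt_succ_r in Lx as [Lx| ->]; [auto|easy].
      + destruct (classic (mem n X)) as [N|N].
        * exists n. split; [apply le_refl|split; [exact N|]].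
          intros x Lx Mx. apply lt_succ_r in Lx as [Lx| ->]; [|now left]. destruct K. eauto.
        * exfalso. destruct Ex as [x [Lx Hx]]. apply lt_succ_r in Lx as [Lx| ->]; eauto. }
  destruct (H k) as [m [_ [Hm Mm]]].
  { exists x0. split; [now apply HX|exact Hx0]. }
  exists m. split; [exact Hm|]. intros x Hx. apply Mm; [now apply HX|exact Hx].
Qed.

(** Only the maximum of [L] and the minimum of [U] matter. If both exist, density gives [s]; if one
    set is empty, the absence of endpoints does. *)
Lemma gap (S L U : sset M) (k : num M) : DLOwoEnd M S ->
  (forall x, mem x L -> mem x S /\ x < k) -> (forall x, mem x U -> mem x S /\ x < k) ->
  (forall x y, mem x L -> mem y U -> qlt M x y) ->
  exists s, mem s S /\ (forall x, mem x L -> qlt M x s) /\ (forall y, mem y U -> qlt M s y).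
Proof.
  intros (SQ & [s0 Hs0] & Dense & NoEnd) HL HU LU.
  assert (LQ : forall x, mem x L -> IsQ M x /\ x < k).
  { intros x Hx. destruct (HL x Hx). auto. }
  assert (UQ : forall x, mem x U -> IsQ M x /\ x < k).
  { intros x Hx. destruct (HU x Hx). auto. }
  destruct (classic (exists x, mem x L)) as [NL|NL];
    [destruct (bounded_extremum true L k LQ NL) as [l [Hl Ml]]|];
  (destruct (classic (exists x, mem x U)) as [NU|NU];
    [destruct (bounded_extremum false U k UQ NU) as [u [Hu Mu]]|]);
  simpl in *.
  - destruct (Dense l u) as [s (Hs & ls & su)]; [apply HL, Hl|apply HU, Hu|auto|].
    exists s. split; [exact Hs|split].
    + intros x Hx. destruct (Ml x Hx) as [->|?]; eauto using qlt_trans.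
    + intros x Hx. destruct (Mu x Hx) as [->|?]; eauto using qlt_trans.
  - destruct (NoEnd l) as [_ [s (_ & Hs & _ & ls)]]; [apply HL, Hl|].
    exists s. split; [exact Hs|split].
    + intros x Hx. destruct (Ml x Hx) as [->|?]; eauto using qlt_trans.
    + intros x Hx. destruct NU. eauto.
  - destruct (NoEnd u) as [s [_ (Hs & _ & su & _)]]; [apply HU, Hu|].
    exists s. split; [exact Hs|split].
    + intros x Hx. destruct NL. eauto.
    + intros x Hx. destruct (Mu x Hx) as [->|?]; eauto using qlt_trans.
  - exists s0. split; [exact Hs0|split]; intros x Hx; [destruct NL|destruct NU]; eauto.
Qed.

(** All elements of the gap with code below [j] are added to [L]. An element found above the
    enlarged [L] cannot have a code below [j], since it would then lie in [L'] and be above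
    itself. *)
Lemma gap_large (S L U : sset M) (k j : num M) : DLOwoEnd M S ->
  (forall x, mem x L -> mem x S /\ x < k) -> (forall x, mem x U -> mem x S /\ x < k) ->
  (forall x y, mem x L -> mem y U -> qlt M x y) ->
  exists s, mem s S /\ j <= s /\
    (forall x, mem x L -> qlt M x s) /\ (forall y, mem y U -> qlt M s y).
Proof.
  intros HS HL HU LU.
  destruct (delta0_comprehension (sets S L U) (fun x j k _ _ _ _ =>
      mem x L \/ (x < j /\ mem x S /\ (forall l, l < k -> mem l L -> qlt M l x) /\
                  forall u, u < k -> mem u U -> qlt M x u))
    ltac:(def0 8) j k 0 0 0 0) as [L' HL'].
  destruct (gap S L' U (k + j) HS) as [s (Hs & Ls & Us)].
  - intros x Hx. apply HL' in Hx as [Hx|(? & ? & ?)].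
    + split; [now apply HL|]. apply (lt_le_trans _ k); [now apply HL|apply le_add_r].
    + split; [assumption|]. apply (lt_le_trans _ j); [assumption|apply le_add_l].
  - intros x Hx. split; [now apply HU|]. apply (lt_le_trans _ k); [now apply HU|apply le_add_r].
  - intros x y Hx Hy. apply HL' in Hx as [Hx|(_ & _ & _ & K)]; [auto|].
    apply K; [now apply HU|exact Hy].
  - exists s. split; [exact Hs|].
    assert (Ls' : forall x, mem x L -> qlt M x s) by (intros x Hx; apply Ls, HL'; now left).
    split; [|split; assumption].
    destruct (le_or_lt j s) as [K|K]; [exact K|]. exfalso. apply (qlt_irrefl s), Ls, HL'.
    right. repeat split; auto.
Qed.

(** [X] consists of the elements that beat every element of smaller code. If [k] bounded [X],
    consider the least code [s] among the elements beating all those below [k]. Then [s] is not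
    below [k], and it is a record: an element [t < s] not below [k] fails to beat some [x] below
    [k], while [s] beats that [x]. *)
Lemma records (d : bool) (S : sset M) : DLOwoEnd M S ->
  exists X, (forall x, mem x X -> mem x S) /\ Infinite M X /\
    forall p q, mem p X -> mem q X -> p < q -> qdir d p q.
Proof.
  intros HS.
  destruct (delta0_comprehension (fun _ => S) (fun s _ _ _ _ _ _ =>
      mem s S /\ forall t, t < s -> mem t S -> qdir d t s)
    ltac:(destruct d; unfold qdir; def0 8) 0 0 0 0 0 0) as [X HX].
  exists X. split; [intros x Hx; now apply HX|split].
  2: { intros p q Hp Hq L. apply HX in Hq as [_ Hq]. apply Hq; [exact L|now apply HX]. }
  intros [k Hk].
  destruct (delta0_comprehension (fun _ => S) (fun x k _ _ _ _ _ => x < k /\ mem x S)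
    ltac:(def0 8) k 0 0 0 0 0) as [L HL].
  (* The empty set, for the side of the gap that carries no constraint. *)
  destruct (delta0_comprehension (fun _ => S) (fun x _ _ _ _ _ _ => x < 0)
    ltac:(def0 8) 0 0 0 0 0 0) as [O HO].
  assert (HL' : forall x, mem x L -> mem x S /\ x < k) by (intros x Hx; now apply and_comm, HL).
  assert (HO' : forall x, ~ mem x O) by (intros x Hx; apply HO in Hx; now apply lt_0_r in Hx).
  destruct (delta0_comprehension (fun _ => S) (fun s k _ _ _ _ _ =>
      mem s S /\ forall t, t < k -> mem t S -> qdir d t s)
    ltac:(destruct d; unfold qdir; def0 8) k 0 0 0 0 0) as [Y HY].
  destruct (least_element Y) as [s [Hs Ms]].
  { destruct d.
    - destruct (gap S L O k HS) as [s (Hs & Ls & _)];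
        try solve [intros; exfalso; eapply HO'; eassumption]; auto.
      exists s. apply HY. split; [exact Hs|]. intros t Lt Mt. apply Ls, HL. auto.
    - destruct (gap S O L k HS) as [s (Hs & _ & Ls)];
        try solve [intros; exfalso; eapply HO'; eassumption]; auto.
      exists s. apply HY. split; [exact Hs|]. intros t Lt Mt. apply Ls, HL. auto. }
  apply HY in Hs as [Hs Ds].
  assert (SQ : SubQ M S) by apply HS.
  assert (ks : ~ s < k).
  { intros K. specialize (Ds s K Hs). destruct d; now apply qlt_irrefl in Ds. }
  apply ks, Hk, HX. split; [exact Hs|]. intros t Lt Mt.
  destruct (classic (t < k)) as [K|K]; [auto|].
  assert (N : exists x, x < k /\ mem x S /\ ~ qdir d x t).
  { apply NNPP. intros N. apply (Ms t Lt), HY. split; [exact Mt|].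
    intros x Lx Mx. apply NNPP. intros D. eauto. }
  destruct N as (x & Lx & Mx & N). specialize (Ds x Lx Mx).
  assert (D : x = t \/ qdir d t x).
  { destruct d; simpl in *; destruct (qlt_total x t) as [?|[?|?]]; auto; easy. }
  destruct D as [->|D]; [easy|]. destruct d; simpl in *; eauto using qlt_trans.
Qed.

(** * Embedding the rationals into a dense set *)

Section Embedding.
Variable S : sset M.
Hypothesis HS : DLOwoEnd M S.

(* A finite partial map is coded by [(a, b, w)], where [w] bounds its values. *)
Definition val (a b w q s : num M) : Prop := s < w /\ coded a b (pair_index q s).

(* [q <= t] makes the range of the final map decidable. *)
Definition cand (a b w q t : num M) : Prop :=
  mem t S /\ q <= t /\
  forall q', q' < q -> IsQ M q' -> forall s, s < w -> coded a b (pair_index q' s) ->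
    (qlt M q' q -> qlt M s t) /\ (qlt M q q' -> qlt M t s).

(** A correct run of the recursion below [n], expressed by a bounded condition. That values are
    unique follows from their being least candidates. *)
Definition approx (n a b w : num M) : Prop :=
  forall q, q < n -> IsQ M q ->
    (exists s, s < w /\ coded a b (pair_index q s)) /\
    forall s, s < w -> coded a b (pair_index q s) ->
      cand a b w q s /\ forall t, t < s -> ~ cand a b w q t.

(** Each value at an argument below [q] is one more constraint on [t], so fewer values leave more
    candidates. *)
Lemma cand_ext (a b w a' b' w' q t : num M) :
  (forall q' s, q' < q -> IsQ M q' -> val a b w q' s -> val a' b' w' q' s) ->
  cand a' b' w' q t -> cand a b w q t.
Proof.
  intros H (Ht & Lt & C). split; [exact Ht|split; [exact Lt|]].
  intros q' L Q s Ls K. destruct (H q' s L Q (conj Ls K)) as [Ls' K']. eauto.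
Qed.

(** At the least argument where two runs differ, they have the same earlier values, hence the same
    candidates and the same least one. *)
Lemma approx_unique (n a b w a' b' w' : num M) :
  approx n a b w -> approx n a' b' w' ->
  forall q s, q < n -> IsQ M q -> val a b w q s -> val a' b' w' q s.
Proof.
  intros A A'.
  (* Every value lies below [w] or [w'], so the bound [w + w'] catches all disagreements. *)
  destruct (delta0_comprehension (fun _ => S) (fun q a b w a' b' w' =>
      IsQ M q /\ exists s, s < w + w' /\ ~ (s < w /\ coded a b (pair_index q s) <->
                                          s < w' /\ coded a' b' (pair_index q s)))
    ltac:(unfold coded, pair_index; def0 8) a b w a' b' w') as [X HX].
  enough (N : forall q, q < n -> ~ mem q X).
  { intros q s L Q V. apply NNPP. intros V'. apply (N q L), HX. split; [exact Q|].
    exists s. split; [apply (lt_le_trans _ w); [apply V|apply le_add_r]|].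
    unfold val in *. tauto. }
  intros q L K. destruct (least_element X) as [p [Hp Mp]]; [now exists q|].
  assert (Lp : p < n).
  { destruct (le_or_lt p q) as [?|G]; [eapply le_lt_trans; eassumption|].
    now apply Mp in G. }
  clear q L K. apply HX in Hp as [Qp [s [Ls D]]].
  assert (E : forall q s, q < p -> IsQ M q -> val a b w q s <-> val a' b' w' q s).
  { intros q s' Lq Qq. apply NNPP. intros N. apply (Mp q Lq), HX. split; [exact Qq|].
    exists s'. split; [|exact N].
    destruct (classic (s' < w)) as [G|G]; [apply (lt_le_trans _ w _ G), le_add_r|].
    destruct (classic (s' < w')) as [G'|G']; [apply (lt_le_trans _ w' _ G'), le_add_l|].
    unfold val in N. tauto. }
  destruct (A p Lp Qp) as [[s1 [L1 C1]] U1], (A' p Lp Qp) as [[s2 [L2 C2]] U2].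
  assert (E12 : forall x y, val a b w p x -> val a' b' w' p y -> x = y).
  { intros x y [Lx Cx] [Ly Cy].
    destruct (U1 x Lx Cx) as [Kx Mx], (U2 y Ly Cy) as [Ky My].
    destruct (lt_trichotomy x y) as [G|[G|G]]; [|exact G|]; exfalso.
    - apply (My x G). revert Kx. apply cand_ext. intros. now apply E.
    - apply (Mx y G). revert Ky. apply cand_ext. intros. now apply E. }
  apply D. split; intros V.
  - rewrite (E12 s s2 V (conj L2 C2)). now split.
  - rewrite <- (E12 s1 s (conj L1 C1) V). now split.
Qed.

(** The values already given to rationals below and above [n] form the two sides of a gap, and
    [gap_large] finds in it an element that is at least [n]. *)
Lemma approx_cand (n a b w : num M) : approx n a b w -> IsQ M n ->
  exists t, cand a b w n t /\ forall t', t' < t -> ~ cand a b w n t'.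
Proof.
  intros A Qn.
  assert (I : forall q s, q < n -> IsQ M q -> s < w ->
    coded a b (pair_index q s) -> cand a b w q s).
  { intros q s L Q Ls C. now apply (A q L Q). }
  destruct (delta0_comprehension (fun _ => S) (fun x n a b w _ _ =>
      x < w /\ exists q, q < n /\ (IsQ M q /\ qlt M q n /\ coded a b (pair_index q x)))
    ltac:(unfold coded, pair_index; def0 8) n a b w 0 0) as [L HL].
  destruct (delta0_comprehension (fun _ => S) (fun x n a b w _ _ =>
      x < w /\ exists q, q < n /\ (IsQ M q /\ qlt M n q /\ coded a b (pair_index q x)))
    ltac:(unfold coded, pair_index; def0 8) n a b w 0 0) as [U HU].
  destruct (delta0_comprehension (fun _ => S) (fun t n a b w _ _ => cand a b w n t)
    ltac:(unfold cand, coded, pair_index; def0 8) n a b w 0 0) as [C HC].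
  destruct (least_element C) as [t [Ht Mt]].
  { destruct (gap_large S L U w n HS) as (s & Hs & Ls & sL & sU).
    - intros x Hx. apply HL in Hx as (Lx & q & Lq & Qq & _ & Cq).
      split; [|exact Lx]. now apply (I q x).
    - intros x Hx. apply HU in Hx as (Lx & q & Lq & Qq & _ & Cq).
      split; [|exact Lx]. now apply (I q x).
    - intros x y Hx Hy. apply HL in Hx as (Lx & q & Lq & Qq & qn & Cq).
      apply HU in Hy as (Ly & r & Lr & Qr & nr & Cr).
      assert (qr : qlt M q r) by eauto using qlt_trans.
      (* Whichever of [q] and [r] has the larger code received its value consistently with the
         other. *)
      destruct (lt_trichotomy q r) as [G|[G|G]].
      + apply (proj2 (proj2 (I r y Lr Qr Ly Cr)) q G Qq x Lx Cq), qr.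
      + subst r. now apply qlt_irrefl in qr.
      + apply (proj2 (proj2 (I q x Lq Qq Lx Cq)) r G Qr y Ly Cr), qr.
    - exists s. apply HC. split; [exact Hs|split; [exact Ls|]].
      intros q Lq Qq x Lx Cq. split; intros G.
      + apply sL, HL. eauto 10.
      + apply sU, HU. eauto 10. }
  exists t. split; [now apply HC|]. intros t' L' K. apply (Mt t' L'), HC, K.
Qed.

Lemma pair_index_mono (m n m' n' : num M) :
  m <= m' -> n <= n' -> pair_index m n <= pair_index m' n'.
Proof.
  rewrite !le_iff. intros [x ->] [y ->]. unfold pair_index.
  exists ((x + y) * (m + n + (m + n) + 1 + (x + y)) + x + x). ring.
Qed.

Lemma approx_succ (n a b w : num M) : approx n a b w -> exists a' b' w', approx (n + 1) a' b' w'.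
Proof.
  intros A. destruct (classic (IsQ M n)) as [Qn|Qn].
  2: { exists a, b, w. intros q L Q. apply lt_succ_r in L as [L| ->]; [auto|easy]. }
  destruct (approx_cand n a b w A Qn) as [t [Ct Mt]].
  destruct (delta0_comprehension (fun _ => S) (fun x n a b w t _ =>
      (exists q, q < n /\ exists s, s < w /\ (x = pair_index q s /\ coded a b (pair_index q s))) \/
      x = pair_index n t)
    ltac:(unfold coded, pair_index; def0 8) n a b w t 0) as [X HX].
  (* The code has to be right for all pairs with argument at most [n] and value below the new bound
     [w + (t + 1)], which exceeds both [t] and the old values. *)
  destruct (finite_set_code X (pair_index n (w + (t + 1)) + 1)) as (a' & b' & C).
  set (w' := w + (t + 1)) in *. exists a', b', w'.
  assert (V : forall q s, q <= n ->
    val a' b' w' q s <-> (q < n /\ val a b w q s) \/ (q = n /\ s = t)).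
  { intros q s Lq. unfold val. split.
    - intros [Ls K]. rewrite C in K by (apply pair_index_mono; auto using lt_le_incl).
      apply HX in K as [(q' & L' & s' & Ls' & K & C')|K];
        apply pair_index_inj in K as [-> ->]; auto.
    - intros K. assert (Ls : s < w').
      { destruct K as [[_ [K _]]|[_ ->]]; unfold w'.
        - apply (lt_le_trans _ w _ K), le_add_r.
        - apply lt_iff. exists w. ring. }
      split; [exact Ls|]. apply C; [apply pair_index_mono; auto using lt_le_incl|].
      apply HX. destruct K as [[G [K1 K2]]|[-> ->]]; [left; eauto 10|now right]. }
  (* Candidates at [q] depend only on the values below [q], where the old and the new map agree. *)
  assert (K : forall q t, q <= n -> (cand a' b' w' q t <-> cand a b w q t)).
  { intros q t' Lq. split; apply cand_ext; intros q' s L' _ G.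
    - apply V; [eauto using lt_le_trans, lt_le_incl|]. left. eauto using lt_le_trans.
    - apply V in G as [[_ G]|[-> _]]; [exact G| |eauto using lt_le_trans, lt_le_incl].
      now apply le_not_lt in Lq. }
  intros q Lq Qq. pose proof Lq as Lq'. apply lt_succ_r in Lq' as [Ln| ->].
  - destruct (A q Ln Qq) as [(s & Hs) H]. split.
    + exists s. apply V; auto.
    + intros s' L' C'.
      destruct (proj1 (V q s' Lq) (conj L' C')) as [[_ [Ls' Cs']]|[-> _]];
        [|now apply lt_irrefl in Ln].
      destruct (H s' Ls' Cs') as [H1 H2]. split; [now apply K|].
      intros u Lu Hu. apply (H2 u Lu). now apply K.
  - split.
    + exists t. apply V; auto.
    + intros s' L' C'.
      destruct (proj1 (V n s' Lq) (conj L' C')) as [[G _]|[_ ->]]; [now apply lt_irrefl in G|].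
      split; [now apply K|]. intros u Lu Hu. apply (Mt u Lu). now apply K.
Qed.

Lemma approx_ex (n : num M) : exists a b w, approx n a b w.
Proof.
  (* A common bound [v] merges the three witnesses into the single unbounded one that
     [sigma1_induction] allows. *)
  assert (H : exists v, exists a, a <= v /\ exists b, b <= v /\ exists w, w <= v /\ approx n a b w).
  { revert n. refine (sigma1_induction (fun _ => S) (fun n v _ _ _ _ _ _ =>
      exists a, a <= v /\ exists b, b <= v /\ exists w, w <= v /\ approx n a b w)
      _ 0 0 0 0 0 0 _ _).
    - unfold approx, cand, coded, pair_index. def0 8.
    - exists 0, 0. split; [apply le_refl|]. exists 0. split; [apply le_refl|].
      exists 0. split; [apply le_refl|]. intros q L. now apply lt_0_r in L.
    - intros n (v & a & _ & b & _ & w & _ & A).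
      destruct (approx_succ n a b w A) as (a' & b' & w' & A').
      exists (a' + b' + w'), a'. split; [apply le_iff; exists (b' + w'); ring|].
      exists b'. split; [apply le_iff; exists (a' + w'); ring|].
      exists w'. split; [apply le_add_l|exact A']. }
  destruct H as (v & a & _ & b & _ & w & _ & A). eauto.
Qed.

Lemma approx_mono (m n a b w : num M) : m <= n -> approx n a b w -> approx m a b w.
Proof. intros L A q Lq. apply A. eapply lt_le_trans; eassumption. Qed.

Definition emb (q s : num M) : Prop :=
  exists a b w, approx (q + 1) a b w /\ val a b w q s.

Lemma emb_val (n a b w q s : num M) :
  approx n a b w -> q < n -> IsQ M q -> (emb q s <-> val a b w q s).
Proof.
  intros A L Q. assert (A' : approx (q + 1) a b w).
  { apply (approx_mono _ n); [|exact A]. now apply add_lt_mono_r. }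
  split.
  - intros (a' & b' & w' & B & V). revert V.
    apply (approx_unique (q + 1)); auto using le_refl.
  - intros V. now exists a, b, w.
Qed.

Lemma emb_ex (q : num M) : IsQ M q -> exists s, emb q s.
Proof.
  intros Q. destruct (approx_ex (q + 1)) as (a & b & w & A).
  destruct (A q (le_refl q) Q) as [(s & V) _]. exists s, a, b, w. auto.
Qed.

Lemma emb_cand (n a b w q s : num M) : approx n a b w -> q < n -> IsQ M q -> emb q s ->
  cand a b w q s /\ forall t, t < s -> ~ cand a b w q t.
Proof.
  intros A L Q H. apply (emb_val n a b w q s A L Q) in H as [Ls C]. now apply A.
Qed.

Lemma emb_fun (q s s' : num M) : IsQ M q -> emb q s -> emb q s' -> s = s'.
Proof.
  intros Q H H'. destruct (approx_ex (q + 1)) as (a & b & w & A).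
  apply (emb_cand _ _ _ _ _ _ A (le_refl q) Q) in H as [C N].
  apply (emb_cand _ _ _ _ _ _ A (le_refl q) Q) in H' as [C' N'].
  destruct (lt_trichotomy s s') as [G|[G|G]]; [|exact G|].
  - now apply N' in C.
  - now apply N in C'.
Qed.

Lemma emb_mem (q s : num M) : IsQ M q -> emb q s -> mem s S /\ q <= s.
Proof.
  intros Q H. destruct (approx_ex (q + 1)) as (a & b & w & A).
  destruct (emb_cand _ a b w q s A (le_refl q) Q H) as [(C & L & _) _]. auto.
Qed.

(** Both values are read off one run; the one whose argument has the larger code was chosen
    consistently with the other. *)
Lemma emb_mono (q q' s s' : num M) :
  IsQ M q -> IsQ M q' -> emb q s -> emb q' s' -> qlt M q q' -> qlt M s s'.
Proof.
  intros Q Q' H H' L. destruct (approx_ex (q + q' + 1)) as (a & b & w & A).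
  assert (Lq : q < q + q' + 1) by apply le_add_r.
  assert (Lq' : q' < q + q' + 1) by apply le_add_l.
  destruct (proj1 (emb_val _ a b w q s A Lq Q) H) as [G K].
  destruct (proj1 (emb_val _ a b w q' s' A Lq' Q') H') as [G' K'].
  destruct (emb_cand _ a b w q s A Lq Q H) as [(_ & _ & C) _].
  destruct (emb_cand _ a b w q' s' A Lq' Q' H') as [(_ & _ & C') _].
  destruct (lt_trichotomy q q') as [T|[<-|T]].
  - now apply (C' q T Q s G K).
  - now apply qlt_irrefl in L.
  - now apply (C q' T Q' s' G' K').
Qed.

(** The graph is Delta_1: since runs exist and agree, some run gives the value [s] at [q] exactly
    when every run does. *)
Lemma emb_set : exists H,
  (forall x, mem x H -> exists q s, PairR M q s x) /\
  forall q s, HRel M H q s <-> IsQ M q /\ emb q s.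
Proof.
  destruct (delta1_comprehension (fun _ => S)
    (fun x v _ _ _ _ _ _ => exists q, q <= x /\ exists s, s <= x /\
      (PairR M q s x /\ IsQ M q /\
       exists a, a <= v /\ exists b, b <= v /\ exists w, w <= v /\
         (approx (q + 1) a b w /\ val a b w q s)))
    (fun x v _ _ _ _ _ _ => exists q, q <= x /\ exists s, s <= x /\
      (PairR M q s x /\ IsQ M q /\
       forall a, a <= v -> forall b, b <= v -> forall w, w <= v ->
         (approx (q + 1) a b w -> val a b w q s)))
    ltac:(unfold val, approx, cand, coded, pair_index; def0 8)
    ltac:(unfold val, approx, cand, coded, pair_index; def0 8)
    0 0 0 0 0 0) as [H HH].
  - intros x. split.
    + intros (v & q & Lq & s & Ls & P & Q & a & _ & b & _ & w & _ & A & V) v'.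
      exists q. split; [exact Lq|]. exists s. split; [exact Ls|].
      split; [exact P|split; [exact Q|]]. intros a' _ b' _ w' _ A'.
      revert V. apply (approx_unique (q + 1)); auto using le_refl.
    (* The instance at 0 decodes [x]; once a run is at hand, the hypothesis is applied at a bound
       that covers its code. *)
    + intros K. destruct (K 0) as (q & Lq & s & Ls & P & Q & _).
      destruct (approx_ex (q + 1)) as (a & b & w & A).
      exists (a + b + w). destruct (K (a + b + w)) as (q' & _ & s' & _ & P' & _ & V).
      destruct (PairR_inj _ _ _ _ _ P P') as [<- <-].
      assert (La : a <= a + b + w) by (apply le_iff; exists (b + w); ring).
      assert (Lb : b <= a + b + w) by (apply le_iff; exists (a + w); ring).
      assert (Lw : w <= a + b + w) by apply le_add_l.
      exists q. split; [exact Lq|]. exists s. split; [exact Ls|].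
      split; [exact P|split; [exact Q|]].
      exists a. split; [exact La|]. exists b. split; [exact Lb|]. exists w. auto.
  - exists H. split.
    { intros x K. apply HH in K as (v & q & _ & s & _ & P & _). now exists q, s. }
    intros q s. split.
    + intros (x & P & K). apply HH in K.
      destruct K as (v & q' & _ & s' & _ & P' & Q & a & _ & b & _ & w & _ & A & V).
      destruct (PairR_inj _ _ _ _ _ P P') as [<- <-]. split; [exact Q|]. now exists a, b, w.
    + intros (Q & a & b & w & A & V). destruct (PairR_ex q s) as [x P].
      exists x. split; [exact P|]. apply HH. exists (a + b + w).
      assert (La : a <= a + b + w) by (apply le_iff; exists (b + w); ring).
      assert (Lb : b <= a + b + w) by (apply le_iff; exists (a + w); ring).
      assert (Lw : w <= a + b + w) by apply le_add_l.
      exists q. split; [eapply PairR_le_l; exact P|].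
      exists s. split; [eapply PairR_le_r; exact P|].
      split; [exact P|split; [exact Q|]].
      exists a. split; [exact La|]. exists b. split; [exact Lb|]. exists w. auto.
Qed.

Lemma dense_contains_Q : exists T, (forall x, mem x T -> mem x S) /\ OrderTypeQ M T.
Proof.
  destruct emb_set as [H [HP HH]].
  (* Values dominate their arguments, so the search for a preimage is bounded and the range is a
     set. *)
  destruct (delta0_comprehension (fun _ => H) (fun s _ _ _ _ _ _ =>
      exists q, q <= s /\ HRel M H q s) ltac:(def0 8) 0 0 0 0 0 0) as [T HT].
  assert (TE : forall s, mem s T <-> exists q, HRel M H q s).
  { intros s. rewrite HT. split; intros [q K]; exists q; [apply K|]. split; [|exact K].
    apply HH in K as [Q K]. now apply (emb_mem q s). }
  assert (TS : forall s, mem s T -> mem s S).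
  { intros s K. apply TE in K as [q K]. apply HH in K as [Q K]. now apply (emb_mem q s). }
  exists T. split; [exact TS|split; [|]].
  { intros s K. apply HS. auto. }
  exists H. repeat split.
  - intros x K. destruct (HP x K) as (q & s & P).
    assert (R : HRel M H q s) by now exists x.
    exists q, s. split; [exact P|]. split; [now apply HH in R as [R _]|].
    apply TE. now exists q.
  - intros q Q. destruct (emb_ex q Q) as [s K]. exists s. apply HH. auto.
  - intros q s s' K K'. apply HH in K as [Q K]. apply HH in K' as [_ K'].
    now apply (emb_fun q).
  - intros s K. apply TE in K as [q K]. exists q. split; [now apply (HH q s)|exact K].
  - intros q q' s s' K K' L. apply HH in K as [Q K]. apply HH in K' as [Q' K'].
    now apply (emb_mono q q').
Qed.

End Embedding.

(** * From four colours to the Erdos-Rado theorem *)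

Lemma one_neq_zero : (1 : num M) <> 0.
Proof. rewrite <- (add_0_l 1). apply succ_neq_zero. Qed.

Lemma lt_two (i : num M) : i < two M -> i = 0 \/ i = 1.
Proof.
  intros H. apply lt_succ_r in H as [H|H]; [left|now right].
  rewrite <- (add_0_l 1) in H. apply lt_succ_r in H as [H|H]; [now apply lt_0_r in H|exact H].
Qed.

Lemma Col_two (F : sset M) : IsColoring M (two M) F ->
  forall p q i, Col M F p q i -> i = 0 \/ i = 1.
Proof.
  intros [FR _] p q i (x & C & K). destruct (FR x K) as (p' & q' & i' & C' & _ & _ & _ & L).
  destruct (Code3_inj _ _ _ _ _ _ _ C C') as (_ & _ & <-). now apply lt_two.
Qed.

(** The colour is [2 * e + c], where [c] is the colour under [F] and [e] is 1 when the codes are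
    ordered like the rationals, 0 otherwise. *)
Definition sierpinski (F : sset M) (p q j : num M) : Prop :=
  (p < q /\ (j = 1 + 1 /\ Col M F p q 0 \/ j = 1 + 1 + 1 /\ Col M F p q 1)) \/
  (~ p < q /\ (j = 0 /\ Col M F p q 0 \/ j = 1 /\ Col M F p q 1)).

Lemma sierpinski_coloring (F : sset M) : IsColoring M (two M) F ->
  exists G, IsColoring M (four M) G /\
    forall p q j, IsQ M p -> IsQ M q -> qlt M p q -> (Col M G p q j <-> sierpinski F p q j).
Proof.
  intros HF. pose proof (Col_two F HF) as F01. destruct HF as (_ & FT & FU).
  destruct (delta0_comprehension (fun _ => F) (fun x _ _ _ _ _ _ =>
      exists p, p <= x /\ exists q, q <= x /\ exists j, j <= x /\
        (Code3 M p q j x /\ IsQ M p /\ IsQ M q /\ qlt M p q /\ sierpinski F p q j))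
    ltac:(unfold sierpinski; def0 8) 0 0 0 0 0 0) as [G HG].
  assert (CG : forall p q j, Col M G p q j <->
    IsQ M p /\ IsQ M q /\ qlt M p q /\ sierpinski F p q j).
  { intros p q j. split.
    - intros (x & C & K). apply HG in K as (p' & _ & q' & _ & j' & _ & C' & K).
      now destruct (Code3_inj _ _ _ _ _ _ _ C C') as (<- & <- & <-).
    - intros K. destruct (Code3_ex p q j) as [x C]. exists x. split; [exact C|].
      destruct (Code3_le _ _ _ _ C) as (Lp & Lq & Lj). apply HG. eauto 10. }
  exists G. split; [split; [|split]|].
  - intros x K. apply HG in K as (p & _ & q & _ & j & _ & C & Qp & Qq & L & K).
    exists p, q, j. repeat (split; [assumption|]).
    unfold four, two. destruct K as [[_ [[-> _]|[-> _]]]|[_ [[-> _]|[-> _]]]]; apply lt_iff.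
    + exists 1. ring.
    + exists 0. ring.
    + exists (1 + 1 + 1). ring.
    + exists (1 + 1). ring.
  - intros p q Qp Qq L. destruct (FT p q Qp Qq L) as [i C].
    enough (K : exists j, sierpinski F p q j).
    { destruct K as [j K]. exists j. apply CG. auto. }
    unfold sierpinski.
    destruct (classic (p < q)) as [D|D], (F01 _ _ _ C) as [-> | ->]; eauto 10.
  - intros p q i j Ki Kj. apply CG in Ki as (_ & _ & _ & Ki), Kj as (_ & _ & _ & Kj).
    assert (N : ~ (Col M F p q 0 /\ Col M F p q 1)).
    { intros [C0 C1]. now apply one_neq_zero, (FU p q). }
    destruct Ki as [[D [[-> Ci]|[-> Ci]]]|[D [[-> Ci]|[-> Ci]]]],
             Kj as [[D' [[-> Cj]|[-> Cj]]]|[D' [[-> Cj]|[-> Cj]]]]; tauto.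
  - intros p q j Qp Qq L. rewrite CG. tauto.
Qed.

Lemma DT_implies_ER : DT2_4_2 M -> ER2 M.
Proof.
  intros DT F HF. pose proof (Col_two F HF) as F01.
  destruct (sierpinski_coloring F HF) as [G [HG CG]].
  destruct (DT G HG) as [S [HS [c1 [c2 HC]]]].
  assert (SQ : SubQ M S) by apply HS.
  assert (SC : forall p q j, mem p S -> mem q S -> qlt M p q -> sierpinski F p q j ->
    j = c1 \/ j = c2).
  { intros p q j Hp Hq L K. apply (HC p q j Hp Hq L). apply CG; auto. }
  destruct (classic (exists p q, mem p S /\ mem q S /\ qlt M p q /\ p < q /\ Col M F p q 1))
    as [(p & q & Hp & Hq & L & D & C)|N].
  (* No agreeing pair has colour 1, and all pairs of increasing records agree. *)
  2: { destruct (records true S HS) as (X & XS & XI & XD). exists X.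
    split; [intros x Hx; auto|]. left. split; [exact XI|].
    intros p q i Hp Hq L C. destruct (F01 _ _ _ C) as [->| ->]; [reflexivity|].
    destruct N. exists p, q. repeat (split; [now auto|]). split; [|exact C].
    destruct (lt_trichotomy p q) as [T|[<-|T]]; [exact T|now apply qlt_irrefl in L|].
    now apply XD, qlt_asym in T. }
  destruct (classic (exists p q, mem p S /\ mem q S /\ qlt M p q /\ ~ p < q /\ Col M F p q 1))
    as [(p' & q' & Hp' & Hq' & L' & D' & C')|N].
  (* Dually, all pairs of decreasing records disagree. *)
  2: { destruct (records false S HS) as (X & XS & XI & XD). exists X.
    split; [intros x Hx; auto|]. left. split; [exact XI|].
    intros p' q' i Hp' Hq' L' C'. destruct (F01 _ _ _ C') as [->| ->]; [reflexivity|].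
    destruct N. exists p', q'. repeat (split; [now auto|]). split; [|exact C'].
    intros T. now apply XD, qlt_asym in T. }
  destruct (dense_contains_Q S HS) as (T & TS & TQ). exists T.
  split; [intros x Hx; auto|]. right. split; [exact TQ|].
  intros r s i Hr Hs Lrs Crs. destruct (F01 _ _ _ Crs) as [->| ->]; [exfalso|reflexivity].
  (* The colours 3 and 1 both occur on [S], so they exhaust [c1] and [c2]; a pair of colour 0 under
     [F] would have colour 2 or 0. *)
  assert (K3 := SC p q (1 + 1 + 1) Hp Hq L ltac:(left; auto)).
  assert (K1 := SC p' q' 1 Hp' Hq' L' ltac:(right; auto)).
  assert (N10 := one_neq_zero).
  assert (N21 : (1 + 1 : num M) <> 1).
  { intros E. apply one_neq_zero, succ_inj. now rewrite E, add_0_l. }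
  assert (N32 : (1 + 1 + 1 : num M) <> 1 + 1) by (intros E; now apply succ_inj in E).
  assert (N31 : (1 + 1 + 1 : num M) <> 1).
  { intros E. apply (succ_neq_zero 1), succ_inj. now rewrite E, add_0_l. }
  assert (N30 : (1 + 1 + 1 : num M) <> 0) by apply succ_neq_zero.
  destruct (classic (r < s)) as [Drs|Drs].
  - assert (K2 := SC r s (1 + 1) (TS r Hr) (TS s Hs) Lrs ltac:(left; auto)).
    destruct K1, K2, K3; congruence.
  - assert (K0 := SC r s 0 (TS r Hr) (TS s Hs) Lrs ltac:(right; auto)).
    destruct K1, K0, K3; congruence.
Qed.

End Model.

Theorem theorem5p44 : forall M : L2, RCA0 M -> DT2_4_2 M -> ER2 M.
Proof.
  (* The colouring [F] itself is the set that the section variable [Z] asks for. *)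
  intros M HM DT F. now apply (DT_implies_ER M HM F).
Qed.
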